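(* For any octuple of positive integers $(L,m,x,y,z,r,R,\rho)$, $$\frac{1}{(q^x,q^y,q^z,q^{rx+Ry+\rho z};q^m)_L}\succcurlyeq\frac{1}{(q^{rx},q^{Ry},q^{\rho z},q^{x+y+z};q^m)_L}.$$
   Context: Here $q$ is a variable with $|q|<1$ (equivalently, a formal variable). Notation: for an integer $L\ge 0$, $(a;q)_L=1$ if $L=0$ and $(a;q)_L=\prod_{j=0}^{L-1}(1-aq^j)$ if $L>0$; and $(a_1,a_2,\dots,a_n;q)_L=(a_1;q)_L(a_2;q)_L\cdots(a_n;q)_L$. Thus, for example, $(q^a;q^m)_L=\prod_{j=0}^{L-1}(1-q^{a+jm})$. For two $q$-products $\Pi_1,\Pi_2$ (identified with their power series expansions in $q$), $\Pi_1\succcurlyeq\Pi_2$ means that for every $n\ge 0$ the coefficient of $q^n$ in $\Pi_1$ is at least the coefficient of $q^n$ in $\Pi_2$; equivalently, the power series of $\Pi_1-\Pi_2$ in $q$ has only nonnegative coefficients. *)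

(* Defs.v *)
From mathcomp Require Import all_boot all_order all_algebra.

Set Implicit Arguments.
Unset Strict Implicit.
Unset Printing Implicit Defensive.

Import Order.TTheory GRing.Theory Num.Theory.
Local Open Scope ring_scope.

(** A formal power series in [q] is its sequence of coefficients. *)
Definition fps (K : Type) := nat -> K.

Definition fps_of_poly (K : nzRingType) (p : {poly K}) : fps K :=
  fun n => p`_n.

Definition fps_one (K : nzRingType) : fps K := fun n => (n == 0%N)%:R.

Definition fps_mul (K : nzRingType) (f g : fps K) : fps K :=
  fun n => \sum_(i < n.+1) f i * g (n - i)%N.

(** [fps_inv_seq f n] lists the coefficients of index [0, ..., n] of [1/f],
    obtained by solving [f * g = 1] degree by degree; this is meaningful when
    [f 0] is a unit (see [fps_mulV] and [fps_invP]). *)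
Fixpoint fps_inv_seq (K : unitRingType) (f : fps K) (n : nat) : seq K :=
  if n is n'.+1 then
    let s := fps_inv_seq f n' in
    rcons s (- ((f 0%N)^-1 * \sum_(i < n'.+1) f i.+1 * s`_(n' - i)%N))
  else [:: (f 0%N)^-1].

Definition fps_inv (K : unitRingType) (f : fps K) : fps K :=
  fun n => (fps_inv_seq f n)`_n.

Definition fps_dominates (K : numDomainType) (f g : fps K) : Prop :=
  forall n : nat, g n <= f n.

Definition qpoch (A : comNzRingType) (a q : A) (L : nat) : A :=
  \prod_(j < L) (1 - a * q ^+ j).

Definition qpochs (A : comNzRingType) (s : seq A) (q : A) (L : nat) : A :=
  \prod_(a <- s) qpoch a q L.

Lemma size_fps_inv_seq (K : unitRingType) (f : fps K) n :
  size (fps_inv_seq f n) = n.+1.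
Proof. by elim: n => //= n IHn; rewrite size_rcons IHn. Qed.

Lemma nth_fps_inv_seq (K : unitRingType) (f : fps K) n i :
  (i <= n)%N -> (fps_inv_seq f n)`_i = fps_inv f i.
Proof.
elim: n => [|n IHn]; first by rewrite leqn0 => /eqP ->.
rewrite leq_eqVlt => /predU1P[-> // | lt_i_n1].
by rewrite /= nth_rcons size_fps_inv_seq lt_i_n1 IHn.
Qed.

Lemma fps_inv0 (K : unitRingType) (f : fps K) : fps_inv f 0 = (f 0%N)^-1.
Proof. by []. Qed.

Lemma fps_invS (K : unitRingType) (f : fps K) n :
  fps_inv f n.+1 =
    - ((f 0%N)^-1 * \sum_(i < n.+1) f i.+1 * fps_inv f (n - i)%N).
Proof.
rewrite {1}/fps_inv /= nth_rcons size_fps_inv_seq ltnn eqxx.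
congr (- _); congr (_ * _); apply: eq_bigr => i _.
by rewrite nth_fps_inv_seq ?leq_subr.
Qed.

Lemma fps_mulV (K : unitRingType) (f : fps K) :
  f 0%N \is a GRing.unit -> fps_mul f (fps_inv f) =1 fps_one K.
Proof.
move=> f0U [|n]; rewrite /fps_mul big_ord_recl.
  by rewrite big_ord0 addr0 subn0 fps_inv0 divrr.
rewrite subn0 fps_invS mulrN mulrA divrr // mul1r.
by rewrite /fps_one /= addrC subrr.
Qed.

Lemma fps_invP (K : unitRingType) (f g : fps K) :
  f 0%N \is a GRing.unit -> fps_mul f g =1 fps_one K -> g =1 fps_inv f.
Proof.
move=> f0U fg1 n; elim/ltn_ind: n => -[_|n IHn].
  have := fg1 0%N; rewrite /fps_mul big_ord_recl big_ord0 addr0 subn0 /fps_one.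
  by rewrite fps_inv0 /= => fg; apply: (mulrI f0U); rewrite divrr.
have := fg1 n.+1; rewrite /fps_mul big_ord_recl subn0 /fps_one /= => /eqP.
rewrite addr_eq0 => /eqP fg; apply: (mulrI f0U).
rewrite fg fps_invS mulrN mulrA divrr // mul1r; congr (- _).
by apply: eq_bigr => i _; rewrite subSS IHn // ltnS leq_subr.
Qed.

Lemma qpochs_coef0 (K : comNzRingType) (s : seq nat) (m L : nat) :
  all (leq 1) s ->
  (qpochs [seq 'X^a | a <- s] 'X^m L : {poly K})`_0 = 1.
Proof.
move=> /allP s_gt0; rewrite /qpochs big_map -horner_coef0 horner_prod.
rewrite big_seq big1 // => a /s_gt0 a_gt0; rewrite /qpoch horner_prod.
rewrite big1 // => j _.
by rewrite -exprM -exprD !hornerE expr0n addn_eq0 eqn0Ngt a_gt0 subr0.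
Qed.

(* Main.v *)
Require Import Defs.
From mathcomp Require Import all_boot all_order all_algebra.
From mathcomp Require Import zify.

Set Implicit Arguments.
Unset Strict Implicit.
Unset Printing Implicit Defensive.

Import Order.TTheory GRing.Theory Num.Theory.
Local Open Scope ring_scope.

(** The coefficient of [q^n] in [1/prod_(a in s) (1 - q^a)] is the number
    [npart s n] of ways to write [n] as a sum of parts taken from the list [s]
    ([fps_inv_prod]), so the theorem compares two families of partitions. The
    four kinds of parts come in [L] layers, the layer of shift [t = jm] being
    [x+t, y+t, z+t, rx+Ry+rho z+t] on the large side and
    [rx+t, Ry+t, rho z+t, x+y+z+t] on the small side.

    The small layers are replaced by the large ones one at a time. For the
    layer of shift 0 the replacement is an injection ([level0_subordinate]). A
    layer of shift [t > 0] is in general not dominated by its large counterpart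
    on its own, but it is in the presence of three spare kinds of parts
    [x, y, z] ([level_subordinate]), and once the layer of shift 0 has been
    replaced it provides them. Domination is preserved by adding parts on both
    sides, so the replacements can be chained ([subordinate_flatten]).

    Both injections are compatible with regarding [x, y, z] and [t] as
    independent: they preserve the total multiples of [x], of [y], of [z] and of
    [t]. With spare parts the multiple [a] of [x] is only an upper bound, since
    spare [x]'s make up the difference: [i] parts [rx+t] and [l] parts [x+y+z+t]
    are possible when [r i + l <= a], whereas [i] parts [x+t] and [l] parts
    [rx+Ry+rho z+t] are possible when [i + r l <= a]; likewise for [y] and [z].
    So one needs, for given bounds [a, b, c], an injection from the quadruples
    [(i, j, k, l)] of the first kind to those of the second kind preserving
    [i + j + k + l]. It leaves alone the quadruples of both kinds; in the others
    some coordinate violates its bound, and [l] is exchanged with the least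
    such coordinate ([exchange_fits], [exchange_inj]). *)

(** * Partitions into parts from a list *)

Section Partitions.
Local Open Scope nat_scope.

Fixpoint weight (s c : seq nat) : nat :=
  match s, c with
  | a :: s', i :: c' => i * a + weight s' c'
  | _, _ => 0
  end.

Fixpoint mult_vectors (s : seq nat) (n : nat) : seq (seq nat) :=
  if s is a :: s' then
    [seq i :: c | i <- [seq i <- iota 0 n.+1 | i * a <= n],
                  c <- mult_vectors s' (n - i * a)]
  else if n == 0 then [:: [::]] else [::].

Lemma mult_vectors_cons a s n :
  mult_vectors (a :: s) n =
    [seq i :: c | i <- [seq i <- iota 0 n.+1 | i * a <= n],
                  c <- mult_vectors s (n - i * a)].
Proof. by []. Qed.

(** Equal entries of [s] at different positions count as parts of different
    colours. *)
Definition npart (s : seq nat) (n : nat) : nat := size (mult_vectors s n).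

Lemma mult_vectors_uniq s n : uniq (mult_vectors s n).
Proof.
elim: s n => [|a s IHs] n; first by rewrite /=; case: eqP.
rewrite mult_vectors_cons; apply: (@allpairs_uniq_dep _ (fun=> _) _ (fun i c => i :: c));
  last by case=> [i c] [j d] _ _ /= [-> ->].
  exact/filter_uniq/iota_uniq.
by move=> i _; apply: IHs.
Qed.

Lemma mem_mult_vectors s n c : all (leq 1) s ->
  (c \in mult_vectors s n) = (size c == size s) && (weight s c == n).
Proof.
elim: s n c => [|a s IHs] n c.
  by case: c => [|i c]; rewrite /= eq_sym; case: eqP.
rewrite mult_vectors_cons => /andP[a_gt0 s_gt0].
apply/allpairsPdep/andP => [[i [d]]|[]].
  rewrite mem_filter => -[/andP[le_ia_n _]]; rewrite IHs //.
  move=> /andP[/eqP szd /eqP wd] -> /=; rewrite szd wd eqxx.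
  by rewrite subnKC.
case: c => // i c szc wc; rewrite /= eqSS in szc; rewrite /= in wc.
have le_ia_n : i * a <= n by lia.
exists i, c; split=> //; first by rewrite mem_filter le_ia_n mem_iota; nia.
by rewrite IHs // szc; apply/eqP; lia.
Qed.

(** Any bound [N > n] on the multiplicity of [a] is allowed, so that sums for
    different values of [n] can be given a common range. *)
Lemma npart_cons a s n N : 0 < a -> n < N ->
  npart (a :: s) n = \sum_(i < N | i * a <= n) npart s (n - i * a).
Proof.
move=> a_gt0 lt_n_N; rewrite /npart mult_vectors_cons.
rewrite size_allpairs_dep sumnE big_map big_filter.
rewrite -[iota _ _]/(index_iota 0 n.+1) big_mkord.
rewrite (big_ord_widen_cond N (fun i => i * a <= n)
  (fun i => size (mult_vectors s (n - i * a)))) //.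
by apply: eq_bigl => i; case: leqP => //=; nia.
Qed.

(** A partition either avoids [a] or contains a copy of [a] that can be removed;
    this is the recurrence encoded by the factor [1 - q^a]. *)
Lemma npart_recr a s n : 0 < a ->
  npart (a :: s) n = npart s n + (if a <= n then npart (a :: s) (n - a) else 0).
Proof.
move=> a_gt0; rewrite (npart_cons s a_gt0 (ltnSn n)).
rewrite big_mkcond big_ord_recl /= mul0n subn0.
congr (_ + _); case: leqP => [le_a_n|lt_n_a]; last first.
  by rewrite big1 // => i _; rewrite ifF // /bump /=; nia.
rewrite (@npart_cons _ _ _ n) ?[RHS]big_mkcond //=; last lia.
apply: eq_bigr => i _; rewrite /bump /= add1n mulSn subnDA.
by rewrite leq_subRL.
Qed.

Definition subordinate (s t : seq nat) := forall n, npart s n <= npart t n.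

Lemma subordinate_catl u s t : subordinate s t -> subordinate (u ++ s) (u ++ t).
Proof.
move=> st; elim: u => //= a u IHu n; rewrite /npart !mult_vectors_cons.
rewrite !size_allpairs_dep !sumnE !big_map.
by apply: leq_sum => i _; apply: IHu.
Qed.

(** Vectors of multiplicities are lists, so [f] is a function on all lists whose
    values matter only at length [size s]. *)
Lemma subordinate_inj (f : seq nat -> seq nat) s t :
    all (leq 1) s -> all (leq 1) t ->
    (forall c, size c = size s ->
       size (f c) = size t /\ weight t (f c) = weight s c) ->
    {in [pred c | size c == size s] &, injective f} ->
  subordinate s t.
Proof.
move=> s_gt0 t_gt0 fP f_inj n; rewrite /npart -(size_map f); apply: uniq_leq_size.
  rewrite map_inj_in_uniq ?mult_vectors_uniq // => c d.
  by rewrite !mem_mult_vectors // => /andP[sc _] /andP[sd _]; apply: f_inj.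
move=> _ /mapP[c + ->]; rewrite !mem_mult_vectors // => /andP[/eqP/fP[-> ->] ->].
by rewrite eqxx.
Qed.

Definition level x y z e t : seq nat := [:: x + t; y + t; z + t; e + t].

(** * The layer of shift 0 *)

Section Exchange.
Variables r R rho : nat.
Hypotheses (r_gt0 : 0 < r) (R_gt0 : 0 < R) (rho_gt0 : 0 < rho).

(** As many times as possible, one part each of [rx], [Ry] and [rho z] is merged
    into a part [rx+Ry+rho z]; all other parts are split into [x]'s, [y]'s and
    [z]'s. *)
Definition merge_triples (c : seq nat) : seq nat :=
  if c is [:: i; j; k; l] then
    let u := minn i (minn j k) in
    [:: r * (i - u) + l; R * (j - u) + l; rho * (k - u) + l; u]
  else c.

(** This makes the minimum in [merge_triples] a strictly decreasing function of
    [l] when the multiples of [x], [y] and [z] are fixed. *)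
Lemma quotient_lt p d e l l' :
  0 < p -> p * d + l = p * e + l' -> l < l' -> e < d.
Proof. by move=> p_gt0 eq_pd lt_l; rewrite -(ltn_pmul2l p_gt0); lia. Qed.

(** The image of [(i, j, k, l)] under [merge_triples] determines
    [r (i - u) + l] and its two analogues, [u] being the least of [i, j, k]. If
    two vectors with the same image had different [l]'s, the one with the
    smaller [l] would have larger differences [i - u], [j - u] and [k - u]; but
    one of these is zero for each vector. *)
Lemma level0_subordinate x y z : 0 < x -> 0 < y -> 0 < z ->
  subordinate (level (r * x) (R * y) (rho * z) (x + y + z) 0)
              (level x y z (r * x + R * y + rho * z) 0).
Proof.
move=> x_gt0 y_gt0 z_gt0; apply: (@subordinate_inj merge_triples).
- by rewrite /= !addn0 !muln_gt0; apply/and5P; split=> //; lia.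
- by rewrite /=; apply/and5P; split=> //; nia.
- move=> [|i [|j [|k [|l []]]]] //= _; split=> //; rewrite !addn0.
  set u := minn _ _; have [ui uj uk] : [/\ u <= i, u <= j & u <= k].
    by rewrite /u; split; lia.
  rewrite -{2}(subnK ui) -{2}(subnK uj) -{2}(subnK uk).
  move: (i - u) (j - u) (k - u) => i' j' k'; clear; lia.
move=> [|i [|j [|k [|l []]]]] // [|i2 [|j2 [|k2 [|l2 []]]]] // _ _ [].
set u := minn i _; set u2 := minn i2 _ => ea eb ec eu.
have [ui uj uk] : [/\ u <= i, u <= j & u <= k] by rewrite /u; split; lia.
have [ui2 uj2 uk2] : [/\ u2 <= i2, u2 <= j2 & u2 <= k2].
  by rewrite /u2; split; lia.
have surplus0 : [|| i - u == 0, j - u == 0 | k - u == 0] by rewrite /u; clear; lia.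
have surplus0_2 : [|| i2 - u2 == 0, j2 - u2 == 0 | k2 - u2 == 0].
  by rewrite /u2; clear; lia.
clearbody u u2.
case: (ltngtP l l2) => [lt_l|gt_l|el].
- have := quotient_lt r_gt0 ea lt_l; have := quotient_lt R_gt0 eb lt_l.
  have := quotient_lt rho_gt0 ec lt_l; move: surplus0; clear; lia.
- have := quotient_lt r_gt0 (esym ea) gt_l; have := quotient_lt R_gt0 (esym eb) gt_l.
  have := quotient_lt rho_gt0 (esym ec) gt_l; move: surplus0_2; clear; lia.
move/eqP: ea; move/eqP: eb; move/eqP: ec.
rewrite el !eqn_add2r !eqn_pmul2l // => /eqP ec /eqP eb /eqP ea.
have -> : i = i2 by move: ea eu ui ui2; clear; lia.
have -> : j = j2 by move: eb eu uj uj2; clear; lia.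
have -> : k = k2 by move: ec eu uk uk2; clear; lia.
by [].
Qed.

(** * A layer in the presence of three spare parts *)

(** For the small layer, [fits r a i l] says that [i] parts [rx+t] and [l] parts
    [x+y+z+t] use at most [a] copies of [x]. For the large layer the same bound
    on [i] parts [x+t] and [l] parts [rx+Ry+rho z+t] is [fits r a l i], with the
    arguments exchanged. *)
Definition fits p a i l := p * i + l <= a.

(** The coordinates to be considered are those for which the bound of the large
    layer fails. *)
Definition exchange a b c i j k l : nat * nat * nat * nat :=
  let failx := ~~ fits r a l i in
  let faily := ~~ fits R b l j in
  let failz := ~~ fits rho c l k in
  if [&& failx, faily ==> (i <= j) & failz ==> (i <= k)] then (l, j, k, i)
  else if faily && (failz ==> (j <= k)) then (i, l, k, j)
  else if failz then (i, j, l, k)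
  else (i, j, k, l).

Lemma rearrangement p i j : 0 < p -> i <= j -> p * i + j <= p * j + i.
Proof. by move=> p_gt0 le_ij; nia. Qed.

Lemma fits_lt p a i l : 0 < p -> fits p a i l -> ~~ fits p a l i -> i < l.
Proof. rewrite /fits => p0 h1 h2; have := @rearrangement p l i p0; lia. Qed.

(** When [l] is exchanged with the least failing coordinate, of value [h < l],
    the other coordinates satisfy the bound of the large layer: if [i] was
    already within the bound, decreasing [l] to [h] only helps; if [i] was not,
    then [h <= i] by minimality, and the rearrangement inequality gives
    [r h + i <= r i + h <= r i + l]. *)
Lemma fits_exchange p a i l h : 0 < p -> fits p a i l -> h < l ->
  ~~ fits p a l i ==> (h <= i) -> fits p a h i.
Proof.
rewrite /fits => p0 f1 hl; case: (leqP (p * l + i) a) => /= [h1 _|h1 hi].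
  apply: leq_trans h1; rewrite leq_add2r leq_mul2l ltnW ?orbT //.
by have := rearrangement p0 hi; lia.
Qed.

Lemma exchange_fits a b c i j k l i' j' k' l' :
    fits r a i l -> fits R b j l -> fits rho c k l ->
    exchange a b c i j k l = (i', j', k', l') ->
  [/\ fits r a l' i', fits R b l' j', fits rho c l' k' &
      i' + j' + k' + l' = i + j + k + l].
Proof.
move=> fx fy fz; have ex := @fits_exchange r a i l _ r_gt0 fx.
have ey := @fits_exchange R b j l _ R_gt0 fy.
have ez := @fits_exchange rho c k l _ rho_gt0 fz.
have lx := fits_lt r_gt0 fx; have ly := fits_lt R_gt0 fy.
have lz := fits_lt rho_gt0 fz.
rewrite /exchange; case: ifP => [/and3P[nx cy cz]|].
  move=> [*]; subst i' j' k' l'; have := lx nx => lt_il.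
  by split=> //; [exact: ey | exact: ez | lia].
case: ifP => [/andP[ny cz] hx|].
  move=> [*]; subst i' j' k' l'; have := ly ny => lt_jl.
  by split=> //; [apply: ex => //; lia | exact: ez | lia].
case: ifP => [nz hy hx|].
  move=> [*]; subst i' j' k' l'; have := lz nz => lt_kl.
  by split=> //; [apply: ex => //; lia | apply: ey => //; lia | lia].
by move=> hz hy hx [*]; subst i' j' k' l'; split=> //; lia.
Qed.

Variant exchange_spec a b c i j k l : nat * nat * nat * nat -> Prop :=
| ExchangeX of ~~ fits r a l i : exchange_spec a b c i j k l (l, j, k, i)
| ExchangeY of ~~ fits R b l j : exchange_spec a b c i j k l (i, l, k, j)
| ExchangeZ of ~~ fits rho c l k : exchange_spec a b c i j k l (i, j, l, k)
| ExchangeNone of fits r a l i & fits R b l j & fits rho c l k :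
    exchange_spec a b c i j k l (i, j, k, l).

Lemma exchangeP a b c i j k l :
  exchange_spec a b c i j k l (exchange a b c i j k l).
Proof.
rewrite /exchange; case: ifP => [/andP[nx _]|hx]; first exact: ExchangeX.
case: ifP => [/andP[ny _]|hy]; first exact: ExchangeY.
case: ifP => [nz|/negbFE hz]; first exact: ExchangeZ.
rewrite hz /= !andbT in hx hy; move/negbFE: hy => hy.
by rewrite hy /= andbT in hx; move/negbFE: hx => hx; apply: ExchangeNone.
Qed.

Lemma fits_gap p a i l l' : fits p a i l -> ~~ fits p a i l' -> l < l'.
Proof. by rewrite /fits; lia. Qed.

(** If [l] was exchanged with [i], the image lies outside the small layer, since
    [fits r a i l] becomes the failing [fits r a l i]; so it is not the image of
    a quadruple left alone. Nor does it come from another quadruple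
    [(i2, j2, k2, l2)] by an exchange of [l2] with [j2]: then [l = i2] and
    [i = j2], so [fits r a i2 j2] fails; but [fits r a i2 l2] holds and
    [j2 < l2]. The other pairs of cases are symmetric. *)
Lemma exchange_inj a b c i j k l i2 j2 k2 l2 :
    fits r a i l -> fits R b j l -> fits rho c k l ->
    fits r a i2 l2 -> fits R b j2 l2 -> fits rho c k2 l2 ->
    exchange a b c i j k l = exchange a b c i2 j2 k2 l2 ->
  [/\ i = i2, j = j2, k = k2 & l = l2].
Proof.
move=> fx fy fz fx2 fy2 fz2.
have lx := fits_lt r_gt0 fx; have ly := fits_lt R_gt0 fy.
have lz := fits_lt rho_gt0 fz.
have lx2 := fits_lt r_gt0 fx2; have ly2 := fits_lt R_gt0 fy2.
have lz2 := fits_lt rho_gt0 fz2.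
case: exchangeP => [n1|n1|n1|n1 n1' n1'']; case: exchangeP => [n2|n2|n2|n2 n2' n2''];
  case=> *; subst.
all: try by split.
all: exfalso.
all: try have := lx n1; try have := ly n1; try have := lz n1.
all: try have := lx2 n2; try have := ly2 n2; try have := lz2 n2.
(* In each case, the attempts that typecheck are those about the coordinates
   exchanged. *)
all: try have := fits_gap fx2 n1; try have := fits_gap fy2 n1.
all: try have := fits_gap fz2 n1.
all: try have := fits_gap fx n2; try have := fits_gap fy n2.
all: try have := fits_gap fz n2.
all: clear; lia.
Qed.

(** The spare parts absorb the change: the total numbers [a, b, c] of copies of
    [x, y, z], spare ones included, are kept. The subtractions do not truncate,
    by [exchange_fits]. *)
Definition exchange_vector (v : seq nat) : seq nat :=
  if v is [:: i0; j0; k0; i; j; k; l] then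
    let a := i0 + (r * i + l) in
    let b := j0 + (R * j + l) in
    let c := k0 + (rho * k + l) in
    let: (i', j', k', l') := exchange a b c i j k l in
    [:: a - (r * l' + i'); b - (R * l' + j'); c - (rho * l' + k'); i'; j'; k'; l']
  else v.

(** The image determines [a, b, c], hence [exchange_inj] applies. *)
Lemma level_subordinate x y z t : 0 < x -> 0 < y -> 0 < z ->
  subordinate ([:: x; y; z] ++ level (r * x) (R * y) (rho * z) (x + y + z) t)
              ([:: x; y; z] ++ level x y z (r * x + R * y + rho * z) t).
Proof.
move=> x_gt0 y_gt0 z_gt0; apply: (@subordinate_inj exchange_vector).
- rewrite /= x_gt0 y_gt0 z_gt0 /=; apply/and5P; split=> //; nia.
- by rewrite /= x_gt0 y_gt0 z_gt0 /=; apply/and5P; split=> //; nia.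
- move=> [|i0 [|j0 [|k0 [|i [|j [|k [|l []]]]]]]] //= _.
  set a := i0 + _; set b := j0 + _; set c := k0 + _.
  case E: exchange => [[[i' j'] k'] l'].
  have [] := exchange_fits _ _ _ E; rewrite /fits ?leq_addl //.
  move=> ha hb hc esum; split=> //=.
  set a' := a - _; set b' := b - _; set c' := c - _.
  (* Both weights depend only on [a, b, c] and the number of parts in the layer. *)
  transitivity (a * x + b * y + c * z + (i + j + k + l) * t); last first.
    by rewrite /a /b /c; lia.
  rewrite -(subnK ha) -(subnK hb) -(subnK hc) -esum -/a' -/b' -/c'.
  by move: a' b' c'; clear; lia.
move=> [|i0 [|j0 [|k0 [|i [|j [|k [|l []]]]]]]] //.
move=> [|i02 [|j02 [|k02 [|i2 [|j2 [|k2 [|l2 []]]]]]]] // _ _ /=.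
set a := i0 + _; set b := j0 + _; set c := k0 + _.
set a2 := i02 + _; set b2 := j02 + _; set c2 := k02 + _.
case E: exchange => [[[i' j'] k'] l'].
case E2: exchange => [[[i2' j2'] k2'] l2'] [].
have [] := exchange_fits _ _ _ E; rewrite /fits ?leq_addl // => ha hb hc _.
have [] := exchange_fits _ _ _ E2; rewrite /fits ?leq_addl // => ha2 hb2 hc2 _.
move=> ea eb ec *; subst i2' j2' k2' l2'.
have eqa : a = a2 by lia.
have eqb : b = b2 by lia.
have eqc : c = c2 by lia.
have /exchange_inj[] : exchange a b c i j k l = exchange a b c i2 j2 k2 l2.
  by rewrite E eqa eqb eqc E2.
all: rewrite /fits ?eqa ?eqb ?eqc ?leq_addl -?eqa -?eqb -?eqc ?leq_addl //.
move=> *; subst i2 j2 k2 l2; rewrite /a /b /c /a2 /b2 /c2 in eqa eqb eqc.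
by congr [:: _, _, _ & _]; lia.
Qed.
End Exchange.
End Partitions.

(** * Generating functions *)

(** Truncating [g] moves the product into the ring of polynomials, where
    associativity is available. *)
Lemma fps_mul_poly (K : comUnitRingType) (p : {poly K}) (g : fps K) n :
  fps_mul (fps_of_poly p) g n = (p * \poly_(i < n.+1) g i)`_n.
Proof.
rewrite coefM; apply: eq_bigr => i _.
by rewrite coef_poly ltnS leq_subr.
Qed.

Lemma fps_inv_prod (K : comUnitRingType) (s : seq nat) : all (leq 1) s ->
  fps_inv (fps_of_poly (\prod_(a <- s) (1 - 'X^a) : {poly K}))
    =1 fun n => (npart s n)%:R.
Proof.
move=> s_gt0 n; apply/esym; move: n; apply: fps_invP => [|n].
  rewrite /fps_of_poly -horner_coef0 horner_prod big_seq big1 ?unitr1 // => a.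
  by move/(allP s_gt0) => a_gt0; rewrite !hornerE expr0n eqn0Ngt a_gt0 subr0.
elim: s s_gt0 n => [_|a s IHs /andP[a_gt0 s_gt0]] n.
  rewrite fps_mul_poly big_nil mul1r coef_poly ltnSn.
  by rewrite /fps_one /npart /=; case: n.
(* The factor [1 - 'X^a] is moved onto the truncated series of [a :: s]. *)
rewrite -(IHs s_gt0) fps_mul_poly big_cons mulrC mulrA mulrC coefM.
apply: eq_bigr => i _; congr (_ * _).
rewrite mulrC mulrBl mul1r coefB coefXnM !coef_poly ltnS leq_subr.
rewrite (npart_recr _ _ a_gt0) natrD; case: ltnP => [lt_a|le_a].
  by rewrite subr0 addr0.
by rewrite ltnS leq_subLR (leq_trans (leq_subr _ _)) ?leq_addl // addrK.
Qed.

Lemma npart_perm s t : all (leq 1) s -> perm_eq s t -> npart s =1 npart t.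
Proof.
move=> s_gt0 eq_st n; have t_gt0 : all (leq 1) t by rewrite -(perm_all _ eq_st).
apply/eqP; rewrite -(eqr_nat int) -(fps_inv_prod int s_gt0 n).
by rewrite -(fps_inv_prod int t_gt0 n) (perm_big _ eq_st).
Qed.

(** * Replacing the layers one by one *)

(** The list [c] is a catalyst: it is used in every step and never used up. *)
Lemma subordinate_flatten (c : seq nat) (A B : nat -> seq nat) (js : seq nat) :
    all (leq 1) c ->
    (forall j, all (leq 1) (A j)) -> (forall j, all (leq 1) (B j)) ->
    (forall j, subordinate (c ++ B j) (c ++ A j)) ->
  subordinate (c ++ flatten [seq B j | j <- js])
              (c ++ flatten [seq A j | j <- js]).
Proof.
move=> c_gt0 A_gt0 B_gt0 BA; elim: js => [|j js IHjs] n //=.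
have Bs_gt0 : all (leq 1) (flatten [seq B j | j <- js]).
  by elim: js {IHjs} => //= i js IH; rewrite all_cat B_gt0.
have As_gt0 : all (leq 1) (flatten [seq A j | j <- js]).
  by elim: js {IHjs Bs_gt0} => //= i js IH; rewrite all_cat A_gt0.
rewrite catA (@npart_perm _ (flatten [seq B j | j <- js] ++ (c ++ B j)));
  [|by rewrite !all_cat c_gt0 B_gt0|by rewrite perm_catC].
apply: leq_trans (subordinate_catl _ (BA j) n) _.
rewrite (@npart_perm _ (A j ++ (c ++ flatten [seq B j | j <- js])));
  [|by rewrite !all_cat c_gt0 A_gt0 Bs_gt0|by rewrite perm_catC -catA perm_catCA].
apply: leq_trans (subordinate_catl _ IHjs n) _.
by rewrite (@npart_perm _ (c ++ (A j ++ flatten [seq A j | j <- js])))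
  ?all_cat ?c_gt0 ?A_gt0 ?As_gt0 // perm_catCA.
Qed.

Lemma qpochs_level (K : comUnitRingType) x y z e m L :
  qpochs [:: 'X^x; 'X^y; 'X^z; 'X^e] ('X^m : {poly K}) L =
    \prod_(a <- flatten [seq level x y z e (j * m) | j <- iota 0 L]) (1 - 'X^a).
Proof.
rewrite big_flatten big_map -[in iota 0 L](subn0 L) big_mkord.
rewrite /qpochs exchange_big; apply: eq_bigr => j _.
by rewrite /level !big_cons !big_nil -exprM !exprD mulnC.
Qed.

Theorem theorem1p2 (L m x y z r R rho : nat)
    (hL : (0 < L)%N) (hm : (0 < m)%N)
    (hx : (0 < x)%N) (hy : (0 < y)%N) (hz : (0 < z)%N)
    (hr : (0 < r)%N) (hR : (0 < R)%N) (hrho : (0 < rho)%N) :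
  let q : {poly int} := 'X in
  fps_dominates
    (fps_inv (fps_of_poly
      (qpochs [:: q ^+ x; q ^+ y; q ^+ z; q ^+ (r * x + R * y + rho * z)]
        (q ^+ m) L)))
    (fps_inv (fps_of_poly
      (qpochs [:: q ^+ (r * x); q ^+ (R * y); q ^+ (rho * z); q ^+ (x + y + z)]
        (q ^+ m) L))).
Proof.
have level_gt0 a b c d t : (0 < a)%N -> (0 < b)%N -> (0 < c)%N -> (0 < d)%N ->
    all (leq 1) (level a b c d t).
  by move=> *; apply/and5P; split=> //; rewrite addn_gt0; apply/orP; left.
pose e := (r * x + R * y + rho * z)%N.
pose A j := level x y z e (j * m).
pose B j := level (r * x) (R * y) (rho * z) (x + y + z) (j * m).
have A_gt0 j : all (leq 1) (A j).
  by apply: level_gt0; rewrite // !addn_gt0 !muln_gt0 hr hx.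
have B_gt0 j : all (leq 1) (B j).
  by apply: level_gt0; rewrite ?addn_gt0 ?muln_gt0 ?hr ?hR ?hrho ?hx.
have flatten_gt0 C js : (forall j : nat, all (leq 1) (C j)) ->
    all (leq 1) (flatten [seq C j | j <- js]).
  by move=> C_gt0; elim: js => //= j js; rewrite all_cat C_gt0.
move=> q n; rewrite !qpochs_level !fps_inv_prod ?flatten_gt0 //.
rewrite ler_nat; case: L hL => // L _.
pose Bs := flatten [seq B j | j <- iota 1 L].
pose As := flatten [seq A j | j <- iota 1 L].
have e_gt0 : (0 < e)%N by rewrite !addn_gt0 !muln_gt0 hr hx.
have As_gt0 : all (leq 1) As by apply: flatten_gt0.
have Bs_gt0 : all (leq 1) Bs by apply: flatten_gt0.
pose c := [:: x; y; z]; have c_gt0 : all (leq 1) c by rewrite /= hx hy hz.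
have le0 := level0_subordinate hr hR hrho hx hy hz.
have le_j j : subordinate (c ++ B j) (c ++ A j).
  exact: level_subordinate.
rewrite -/(npart (B 0 ++ Bs) n) -/(npart (A 0 ++ As) n).
(* The layer of shift 0 goes first: its replacement [A 0] contains the catalyst
   [c] needed for the other layers. *)
rewrite (@npart_perm _ (Bs ++ B 0)); [|by rewrite all_cat B_gt0|by rewrite perm_catC].
apply: leq_trans (subordinate_catl Bs le0 n) _.
have perm_A0 : perm_eq (A 0) ([:: e] ++ c).
  by rewrite perm_sym perm_catC /A /level !addn0.
have -> : npart (Bs ++ A 0) n = npart ([:: e] ++ (c ++ Bs)) n.
  apply: npart_perm; first by rewrite all_cat A_gt0 Bs_gt0.
  by rewrite perm_catC (catA [:: e] c Bs) perm_cat2r.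
have -> : npart (A 0 ++ As) n = npart ([:: e] ++ (c ++ As)) n.
  apply: npart_perm; first by rewrite all_cat A_gt0 As_gt0.
  by rewrite (catA [:: e] c As) perm_cat2r.
by apply: subordinate_catl; apply: subordinate_flatten.
Qed.
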